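(* Assume that $\mathcal{J}$ is twice differentiable on $\mathcal{V}$ with $$\Gamma=\sup_{\xi\in\mathcal{V}}\|\mathrm{D}^2\mathcal{J}(\xi)\|_{\mathcal{L}(\mathcal{V},\mathcal{V}^* )}<\infty,$$ and that there are $\gamma>0$ and a neighbourhood $\mathcal{U}$ of $\Phi^*$ such that for all $\Phi,\Psi\in\mathcal{U}$, $$\mathcal{J}(\Phi)\ge\mathcal{J}(\Psi)+\mathrm{D}\mathcal{J}(\Psi)(\Phi-\Psi)+\frac{\gamma}{2}\|\Phi-\Psi\|_{\mathcal{V}}^2 .$$ Assume that $\Phi^{*(\mathcal{M},N)}\in\mathcal{U}$ (almost surely). Let $a>0$ and define $$p(a,N):=\mathbb{P}\left[\mathcal{E}_{\mathrm{gen}}\ge\tfrac12 a\Gamma\mathcal{E}_{\mathrm{best}}^2\right].$$ Then, with probability at least $1-p(a,N)$, $$\mathcal{E}_{\mathrm{best}}^2\le\mathcal{E}_{\mathrm{norm}}^2\le(1+a)\frac{\Gamma}{\gamma}\mathcal{E}_{\mathrm{best}}^2 .$$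
   Context: Let $\mathcal{V}$ be a (real) Hilbert space and $(\Omega,\Sigma,\rho)$ a probability space (a finite measure is normalized to a probability measure by rescaling the loss). Let $\ell:\mathcal{V}\times\Omega\to\mathbb{R}$ be a loss function such that $\ell(\cdot;x)$ is continuous for every $x\in\Omega$ and $\ell(\Phi;\cdot)$ is $\rho$-integrable for every $\Phi\in\mathcal{V}$. The cost functional is $\mathcal{J}(\Phi)=\int_\Omega \ell(\Phi;x)\,\mathrm{d}\rho(x)$. Let $x^1,\dots,x^N$ be independent samples distributed according to $\rho$; the empirical cost functional is $\mathcal{J}_N(\Phi)=\frac1N\sum_{i=1}^N\ell(\Phi;x^i)$. Let $\mathcal{M}\subseteq\mathcal{V}$ be a nonempty compact set (the model class). A global minimizer $\Phi^*\in\arg\min_{\Phi\in\mathcal{V}}\mathcal{J}(\Phi)$ is assumed to exist; let $\Phi^{*(\mathcal{M})}\in\arg\min_{\Phi\in\mathcal{M}}\mathcal{J}(\Phi)$ and let $\Phi^{*(\mathcal{M},N)}\in\arg\min_{\Phi\in\mathcal{M}}\mathcal{J}_N(\Phi)$ (which depends on the samples; chosen so that the quantities below are random variables). Define $\mathcal{E}_{\mathrm{gen}}=|\mathcal{J}(\Phi^{*(\mathcal{M})})-\mathcal{J}(\Phi^{*(\mathcal{M},N)})|$, $\mathcal{E}_{\mathrm{norm}}=\|\Phi^*-\Phi^{*(\mathcal{M},N)}\|_{\mathcal{V}}$ and $\mathcal{E}_{\mathrm{best}}=\inf_{\Phi\in\mathcal{M}}\|\Phi^*-\Phi\|_{\mathcal{V}}$.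 $\mathbb{P}$ is the probability with respect to the random samples. *)

(* Defs.v *)
From HB Require Import structures.
From mathcomp Require Import all_boot all_order all_algebra.
From mathcomp Require Import all_classical all_reals all_analysis.

Set Implicit Arguments.
Unset Strict Implicit.
Unset Printing Implicit Defensive.
Import Order.TTheory GRing.Theory Num.Theory.
Import numFieldNormedType.Exports.

Local Open Scope classical_set_scope.
Local Open Scope ring_scope.

Definition hilbert_space (R : realType) (V : completeNormedModType R) : Prop :=
  exists dot : {dot V for idfun}, forall v : V, `|v| ^+ 2 = dot v v.

Definition argmin (R : realType) (T : Type) (A : set T) (f : T -> R) : set T :=
  [set x | A x /\ forall y, A y -> f x <= f y].

Section SecondDerivative.
Context {R : realType} {V : normedModType R}.
Implicit Types (f : V -> R) (x : V) (B : V -> V -> R).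

(* Norms take values in \bar R, with value +oo on unbounded arguments. *)
Definition dual_norm (g : V -> R) : \bar R :=
  ereal_sup [set `|g k|%:E | k in [set k : V | `|k| <= 1]].

(* B stands for the map h |-> B h from V to its dual. *)
Definition op_norm B : \bar R :=
  ereal_sup [set dual_norm (B h) | h in [set h : V | `|h| <= 1]].

(* Frechet derivative at x of the map 'd f from V to its dual. *)
Definition is_diff2 f x B : Prop :=
  [/\ forall h, scalar (B h),
      forall k, scalar (B^~ k),
      (op_norm B < +oo)%E &
      forall e : R, 0 < e -> \forall h \near (0 : V),
        (dual_norm (fun k => 'd f (x + h) k - 'd f x k - B h k)%R
           <= (e * `|h|)%:E)%E].

Definition twice_differentiable f : Prop :=
  (forall x, differentiable f x) /\ (forall x, exists B, is_diff2 f x B).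

Definition diff2 f x : V -> V -> R := get (is_diff2 f x).

End SecondDerivative.

Definition mutually_independent (R : realType) (dT dO : measure_display)
    (T : measurableType dT) (Omega : measurableType dO) (P : probability T R)
    (N : nat) (X : 'I_N -> {RV P >-> Omega}) : Prop :=
  forall (I : {set 'I_N}) (A : 'I_N -> set Omega),
    (forall i, measurable (A i)) ->
    P (\bigcap_(i in [set` I]) (X i @^-1` A i)) =
    (\prod_(i in I) P (X i @^-1` A i))%E.

Section Learning.
Context {R : realType} {V : completeNormedModType R} {dO : measure_display}
  {Omega : measurableType dO}.

Definition cost (rho : probability Omega R) (l : V -> Omega -> R) (Phi : V) : R :=
  \int[rho]_x l Phi x.

Definition emp_cost (l : V -> Omega -> R) (N : nat) (x : 'I_N -> Omega)
    (Phi : V) : R :=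
  N%:R^-1 * \sum_(i < N) l Phi (x i).

Definition err_gen (J : V -> R) (PhiM PhiMN : V) : R := `|J PhiM - J PhiMN|.

Definition err_norm (Phis PhiMN : V) : R := `|Phis - PhiMN|.

Definition err_best (Phis : V) (M : set V) : R :=
  inf [set `|Phis - Phi| | Phi in M].

End Learning.

(* Main.v *)
Require Import Defs.
From HB Require Import structures.
From mathcomp Require Import all_boot all_order all_algebra.
From mathcomp Require Import all_classical all_reals all_analysis.
From mathcomp Require Import measurable_realfun ring lra.

Set Implicit Arguments.
Unset Strict Implicit.
Unset Printing Implicit Defensive.
Import Order.TTheory GRing.Theory Num.Theory.
Import numFieldNormedType.Exports.

Local Open Scope classical_set_scope.
Local Open Scope ring_scope.

(** The bound is deterministic on the event where the generalization error is
small.  Write [J] for the cost, [x] for its global minimizer, [xM] for its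
minimizer over the model class [M] and [xN] for the empirical minimizer.

Since the derivative of [J] vanishes at [x], the strong convexity inequality at
[x] gives [gamma / 2 * |x - xN|^2 <= J xN - J x], and the right-hand side is at
most [|J xM - J xN| + (J xM - J x)].  The first term is the generalization
error.  The second is at most [Gamma / 2 * Ebest^2]: because the second
derivative is bounded by [Gamma], [J] grows at most quadratically away from its
minimizer ([argmin_quadratic_growth]), so [J xM - J x <= J y - J x <=
Gamma / 2 * |x - y|^2] for every [y] in [M], and one takes the infimum over [y].
Hence [Enorm^2 <= (1 + a) * (Gamma / gamma) * Ebest^2] as soon as the
generalization error is below [a * Gamma / 2 * Ebest^2]
([argmin_sqr_dist_le]).  The inequality [Ebest <= Enorm] always holds, [xN]
being a point of [M].

The quadratic growth is reduced to real functions of one variable by restricting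
[J] to the line through [x] and [y]; the mean value theorem is applied twice,
once to bound the slope and once to bound the values. *)

(** * Restriction to lines *)

Lemma nonpos_derive_le (R : realType) (f : R -> R) (r : R) : 0 <= r ->
  (forall t, derivable f t 1) -> (forall t, 0 <= t -> 'D_1 f t <= 0) ->
  f r <= f 0.
Proof.
move=> r0 df df0.
have [||c c0r fr] := @MVT_segment R f (fun t => 'D_1 f t) 0 r r0.
- by move=> t _; exact: DeriveDef.
- exact: derivable_within_continuous.
rewrite -subr_le0 fr subr0 mulr_le0_ge0//.
by apply: df0; move: c0r; rewrite in_itv/= => /andP[].
Qed.

Lemma dual_norm_ubound (R : realType) (V : normedModType R) (g : V -> R) k :
  `|k| <= 1 -> (`|g k|%:E <= dual_norm g)%E.
Proof. by move=> k1; apply: ereal_sup_ubound; exists k. Qed.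

Lemma op_norm_ubound (R : realType) (V : normedModType R) (B : V -> V -> R)
  h k : `|h| <= 1 -> `|k| <= 1 -> (`|B h k|%:E <= op_norm B)%E.
Proof.
move=> h1 k1; apply: (le_trans (dual_norm_ubound _ k1)).
by apply: ereal_sup_ubound; exists h.
Qed.

Section line.
Context {R : realType} {V : normedModType R}.
Variables (f : V -> R) (x u : V).

Lemma is_derive_line t : differentiable f (x + t *: u) ->
  is_derive t 1 (fun s : R => f (x + s *: u)) ('d f (x + t *: u) u).
Proof.
move=> dfx; have := @diff_derivable _ _ _ _ _ u dfx.
have := @deriveE _ _ _ _ _ u dfx.
rewrite /derive /derivable.
have -> : (fun h : R => h^-1 *: (f (h *: u + (x + t *: u)) - f (x + t *: u))) =
  (fun h : R => h^-1 *: (f (x + (h *: 1 + t) *: u) - f (x + t *: u))).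
  apply/funext => h; congr (_ *: (f _ - _)).
  by rewrite scalerDl addrCA /GRing.scale /= mulr1.
by move=> dE cf; apply: DeriveDef.
Qed.

(** Restricting to a unit direction makes both arguments of the remainder
estimate visible: the increment [h *: u] has norm [`|h|], and [u] itself lies in
the unit ball over which the dual norm is a supremum. *)
Lemma is_derive_diff_line (B : V -> V -> R) t : `|u| = 1 ->
  is_diff2 f (x + t *: u) B ->
  is_derive t 1 (fun s : R => 'd f (x + s *: u) u) (B u u).
Proof.
move=> u1 [_ Bl _ Bd].
have cv : (fun h : R => h^-1 *: ('d f (x + (h *: 1 + t) *: u) u -
    'd f (x + t *: u) u)) @ 0^' --> B u u.
  apply/cvgrPdist_le => e e0.
  have /nbhs_normP[d /= d0 dB] := Bd _ e0.
  apply/nbhs_normP; exists d => //= h; rewrite /ball_/= sub0r normrN => hd h0.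
  have := dB (h *: u).
  rewrite /ball_/= sub0r normrN normrZ u1 mulr1 => /(_ hd) Bh.
  have {Bh}:= le_trans (dual_norm_ubound _ _) Bh.
  move=> /(_ u); rewrite u1 lexx => /(_ isT); rewrite lee_fin.
  have -> : B (h *: u) u = h * B u u.
    (* Additivity at 0 gives B 0 u = B 0 u + B 0 u. *)
    have B0 : B 0 u = 0.
      have := Bl u 1 0 0; rewrite scaler0 addr0 /= mul1r.
      by move: (B 0 u) => b; lra.
    by have := Bl u h u 0; rewrite !addr0 B0 addr0.
  have -> : x + (h *: 1 + t) *: u = x + t *: u + h *: u.
    by rewrite scalerDl addrA addrAC /GRing.scale /= mulr1.
  set D := ('d f _ u - 'd f _ u : R) => DB.
  have -> : B u u - h^-1 *: D = h^-1 * - (D - h * B u u).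
    by rewrite /GRing.scale /=; field.
  by rewrite normrM normrN normfV mulrC ler_pdivrMr ?normr_gt0.
by apply: DeriveDef; [exact: cvgP cv|exact: cvg_lim cv].
Qed.

End line.

(** * Quadratic growth around a global minimizer *)

(** Fermat's rule, applied to the restriction of [f] to the line [x + s *: u]. *)
Lemma argmin_diff0 (R : realType) (V : normedModType R) (f : V -> R) x u :
  (forall y, differentiable f y) -> argmin setT f x -> 'd f x u = 0.
Proof.
move=> df [_ fx]; have := @derive1_at_min R (fun s => f (x + s *: u)) (-1) 1 0.
have -> : -1 <= 1 :> R by lra.
move=> /(_ isT) [||t _|_].
- by move=> t _; have /@ex_derive := is_derive_line (df (x + t *: u)).
- by rewrite in_itv/=; lra.
- by rewrite scale0r addr0; exact: fx.
have /@derive_val -> := is_derive_line (df (x + 0 *: u)).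
by rewrite scale0r addr0.
Qed.

Lemma diff2_bound (R : realType) (V : normedModType R) (f : V -> R) G x u :
  (ereal_sup [set op_norm (diff2 f xi) | xi in [set: V]] <= G%:E)%E ->
  `|u| = 1 -> `|diff2 f x u u| <= G.
Proof.
move=> hG u1; rewrite -lee_fin; apply: le_trans hG.
apply: le_trans (op_norm_ubound _ _ _) _; last 1 first.
- by apply: ereal_sup_ubound; exists x.
- by rewrite u1.
- by rewrite u1.
Qed.

(** Along the line, the slope starts at [0] and increases at rate at most [G], so
it is at most [G * t] at time [t]; integrating gives [G / 2 * r ^+ 2].  Both
steps subtract the bound and use that a nonpositive derivative forbids growth,
which replaces the integrals. *)
Lemma quadratic_growth_line (R : realType) (V : normedModType R) (f : V -> R)
    G x u r :
  twice_differentiable f ->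
  (ereal_sup [set op_norm (diff2 f xi) | xi in [set: V]] <= G%:E)%E ->
  'd f x u = 0 -> `|u| = 1 -> 0 <= r ->
  f (x + r *: u) <= f x + G / 2 * r ^+ 2.
Proof.
move=> d2f hG dfx0 u1 r0; have [df df2] := d2f.
have D1 (t : R) : is_derive t 1 (fun s : R => f (x + s *: u)) ('d f (x + t *: u) u).
  exact: is_derive_line.
have D2 (t : R) : is_derive t 1 (fun s : R => 'd f (x + s *: u) u)
    (diff2 f (x + t *: u) u u).
  by apply: is_derive_diff_line => //; exact: getPex (df2 _).
have DG (t : R) : is_derive t 1 (fun s : R => G * s) G.
  by apply: is_derive_eq; rewrite /GRing.scale/= mulr1 ?addr0.
have DG2 (t : R) : is_derive t 1 (fun s : R => G / 2 * s ^+ 2) (G * t).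
  by apply: is_derive_eq; rewrite /GRing.scale/= mulr1; field.
have slope t : 0 <= t -> 'd f (x + t *: u) u <= G * t.
  move=> t0; rewrite -subr_le0.
  have Dg s := is_deriveB (D2 s) (DG s).
  have := @nonpos_derive_le R _ t t0 (fun s => @ex_derive _ _ _ _ _ _ _ (Dg s)).
  rewrite !fctE /= scale0r addr0 dfx0 mulr0 subr0; apply => s s0.
  rewrite (@derive_val _ _ _ _ _ _ _ (Dg s)) subr_le0.
  exact: le_trans (ler_norm _) (diff2_bound _ hG u1).
have Dg s := is_deriveB (D1 s) (DG2 s).
have := @nonpos_derive_le R _ r r0 (fun s => @ex_derive _ _ _ _ _ _ _ (Dg s)).
rewrite !fctE /= scale0r addr0 expr0n/= mulr0 subr0 lerBlDr; apply => s s0.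
by rewrite (@derive_val _ _ _ _ _ _ _ (Dg s)) subr_le0 slope.
Qed.

Lemma argmin_quadratic_growth (R : realType) (V : normedModType R) (f : V -> R)
    G x y :
  twice_differentiable f ->
  (ereal_sup [set op_norm (diff2 f xi) | xi in [set: V]] <= G%:E)%E ->
  argmin setT f x -> f y <= f x + G / 2 * `|x - y| ^+ 2.
Proof.
move=> d2f hG fx; have [->|xy] := eqVneq x y.
  by rewrite subrr normr0 expr0n/= mulr0 addr0.
have n0 : `|y - x| != 0 by rewrite normr_eq0 subr_eq0 eq_sym.
have := @quadratic_growth_line R V f G x (`|y - x|^-1 *: (y - x)) `|y - x| d2f hG.
rewrite scalerA divff// scale1r [in X in f X]addrC subrK [`|x - y|]distrC; apply => //.
- exact: argmin_diff0 d2f.1 fx.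
- by rewrite normrZ normfV normr_id mulVf.
Qed.

(** * From the event of small generalization error to the error bound *)

(** The part of [~` A] outside [G] is negligible, so [~` A] weighs no more than
[G]. *)
Lemma probability_ae_implyC d (T : measurableType d) (R : realType)
    (P : probability T R) (A G : set T) :
  measurable A -> measurable G -> {ae P, forall w, ~ A w -> G w} ->
  (1 - P A <= P G)%E.
Proof.
move=> mA mG AG; rewrite -probability_setC//.
have mAG : measurable (~` A `\` G) by apply: measurableD => //; exact: measurableC.
have AG0 : P (~` A `\` G) = 0%E.
  apply/(negligibleP P mAG); apply: negligibleS AG => w /= [nA nG] AG.
  exact/nG/AG.
apply: (@le_trans _ _ (P (G `|` (~` A `\` G)))).
  apply: le_measure; rewrite ?inE//; [exact: measurableC|exact: measurableU|].
  by move=> w nA; have [Gw|nG] := pselect (G w); [left|right].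
by rewrite -[leRHS]adde0 -AG0; exact: measureU2.
Qed.

(** Strong convexity at the minimizer [x] turns the excess cost of [xN] into a
squared distance; quadratic growth bounds the excess cost of [xM] by the squared
distance from [x] to [M].  The strict hypothesis on [`|J xM - J xN|] excludes
[G = 0], so that the proof can divide by [G]. *)
Lemma argmin_sqr_dist_le (R : realType) (V : normedModType R) (J : V -> R)
  (M U : set V) (x xM xN : V) (G g a : R) :
  twice_differentiable J ->
  (ereal_sup [set op_norm (diff2 J xi) | xi in [set: V]] <= G%:E)%E ->
  0 < g -> U x ->
  (forall y z : V, U y -> U z ->
     J z + 'd J z (y - z) + g / 2 * `|y - z| ^+ 2 <= J y) ->
  argmin setT J x -> argmin M J xM -> M xN -> U xN ->
  `|J xM - J xN| < 2^-1 * a * G * inf [set `|x - y| | y in M] ^+ 2 ->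
  `|x - xN| ^+ 2 <= (1 + a) * (G / g) * inf [set `|x - y| | y in M] ^+ 2.
Proof.
move=> d2J hG g0 Ux Jconv xmin [MxM xMmin] MxN UxN.
set E := inf _ => gen.
have G0 : 0 < G.
  have : 0 <= G.
    rewrite -lee_fin; apply: le_trans hG; apply: (@le_trans _ _ (op_norm (diff2 J x))).
      apply: le_trans (@op_norm_ubound _ _ _ 0 0 _ _); by rewrite ?lee_fin// normr0.
    by apply: ereal_sup_ubound; exists x.
  rewrite le_eqVlt => /predU1P[G0|//]; move: gen.
  by rewrite -G0 mulr0 mul0r ltNge normr_ge0.
have E0 : 0 <= E by apply: lb_le_inf; [exists `|x - xM|, xM|move=> _ [y _ <-]].
(* Bounding the square root of (J xM - J x) * (2 / G) by every distance to M
   brings the estimate to a lower bound of the infimum E. *)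
have best : J xM - J x <= G / 2 * E ^+ 2.
  have D0 : 0 <= (J xM - J x) * (2 / G).
    by rewrite mulr_ge0 ?divr_ge0 ?(ltW G0)// subr_ge0; exact: xmin.2.
  rewrite -[leLHS](@mulfK _ (2 / G)) ?mulf_neq0 ?invr_eq0 ?gt_eqF// invf_div.
  rewrite mulrC ler_pM2l ?divr_gt0// -[leLHS]sqr_sqrtr//.
  rewrite ler_pXn2r ?nnegrE ?sqrtr_ge0//; apply: lb_le_inf.
    by exists `|x - xM|, xM.
  move=> _ [y My <-]; rewrite -(ler_pXn2r (n := 2)) ?nnegrE ?sqrtr_ge0//.
  rewrite sqr_sqrtr// mulrA ler_pdivrMr//.
  have := argmin_quadratic_growth y d2J hG xmin; have := xMmin _ My.
  by lra.
have := Jconv _ _ UxN Ux.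
rewrite (argmin_diff0 _ d2J.1 xmin) addr0 distrC.
have /ler_normlP[gen1 gen2] := ltW gen.
have -> : (1 + a) * (G / g) * E ^+ 2 = ((1 + a) * (G / 2) * E ^+ 2) * (2 / g).
  by field; rewrite gt_eqF.
rewrite -ler_pdivrMr ?divr_gt0// invf_div.
move: best gen1; set n := `|x - xN| ^+ 2; set E2 := E ^+ 2; by lra.
Qed.

Theorem corollary4p22
  (R : realType) (V : completeNormedModType R) (hV : hilbert_space V)
  (dO : measure_display) (Omega : measurableType dO) (rho : probability Omega R)
  (l : V -> Omega -> R)
  (l_cont : forall x : Omega, continuous (l^~ x))
  (l_int : forall Phi : V, rho.-integrable setT (EFin \o l Phi))
  (dT : measure_display) (T : measurableType dT) (P : probability T R)
  (N : nat) (hN : (0 < N)%N) (X : 'I_N -> {RV P >-> Omega})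
  (X_indep : mutually_independent X)
  (X_distr : forall (i : 'I_N) (A : set Omega), measurable A ->
     distribution P (X i) A = rho A)
  (M : set V) (M_neq0 : M !=set0) (M_compact : compact M)
  (Phis : V) (hPhis : argmin setT (cost rho l) Phis)
  (PhiM : V) (hPhiM : argmin M (cost rho l) PhiM)
  (PhiMN : ('I_N -> Omega) -> V)
  (hPhiMN : forall x : 'I_N -> Omega, argmin M (emp_cost l x) (PhiMN x))
  (mgen : measurable_fun setT
     (fun w : T => err_gen (cost rho l) PhiM (PhiMN (fun i => X i w))))
  (mnorm : measurable_fun setT
     (fun w : T => err_norm Phis (PhiMN (fun i => X i w))))
  (J_diff2 : twice_differentiable (cost rho l))
  (Gamma : R)
  (hGamma : Gamma%:E =
     ereal_sup [set op_norm (diff2 (cost rho l) xi) | xi in [set: V]])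
  (gamma : R) (gamma_gt0 : 0 < gamma)
  (U : set V) (hU : nbhs Phis U)
  (J_convex : forall Phi Psi : V, U Phi -> U Psi ->
     cost rho l Psi + 'd (cost rho l) Psi (Phi - Psi)
       + gamma / 2 * `|Phi - Psi| ^+ 2 <= cost rho l Phi)
  (hPhiMN_U : {ae P, forall w : T, U (PhiMN (fun i => X i w))})
  (a : R) (a_gt0 : 0 < a) :
  let Egen w := err_gen (cost rho l) PhiM (PhiMN (fun i => X i w)) in
  let Enorm w := err_norm Phis (PhiMN (fun i => X i w)) in
  let Ebest := err_best Phis M in
  let p := P [set w : T | Egen w >= 2^-1 * a * Gamma * Ebest ^+ 2] in
  let good := [set w : T | Ebest ^+ 2 <= Enorm w ^+ 2
    /\ Enorm w ^+ 2 <= (1 + a) * (Gamma / gamma) * Ebest ^+ 2] in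
  (1 - p <= P good)%E.
Proof.
pose Egen w := err_gen (cost rho l) PhiM (PhiMN (fun i => X i w)).
pose Enorm w := err_norm Phis (PhiMN (fun i => X i w)).
pose Ebest := err_best Phis M.
apply: (@probability_ae_implyC _ _ _ _
  [set w : T | Egen w >= 2^-1 * a * Gamma * Ebest ^+ 2]
  [set w : T | Ebest ^+ 2 <= Enorm w ^+ 2
    /\ Enorm w ^+ 2 <= (1 + a) * (Gamma / gamma) * Ebest ^+ 2]).
- rewrite [X in measurable X](_ : _ =
    setT `&` Egen @^-1` `[2^-1 * a * Gamma * Ebest ^+ 2, +oo[).
    exact: mgen.
  by apply/seteqP; split => w /=; rewrite in_itv/= andbT// => -[].
- rewrite [X in measurable X](_ : _ = setT `&` (fun w => Enorm w ^+ 2) @^-1`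
    `[Ebest ^+ 2, (1 + a) * (Gamma / gamma) * Ebest ^+ 2]).
    by apply: measurable_funX.
  apply/seteqP; split => w /=; rewrite in_itv/=.
    by move=> [-> ->].
  by move=> [_ /andP[]].
apply: filterS hPhiMN_U => w UxN /= /negP; rewrite -ltNge => Egen_lt.
have MxN := (hPhiMN (fun i => X i w)).1.
split; last first.
  apply: (argmin_sqr_dist_le J_diff2 _ gamma_gt0 (nbhs_singleton hU) J_convex hPhis
    hPhiM MxN UxN Egen_lt).
  by rewrite -hGamma.
have lb : has_lbound [set `|Phis - Phi| | Phi in M].
  by exists 0 => _ [y _ <-].
have Ebest_ge0 : 0 <= Ebest.
  apply: lb_le_inf; last by move=> _ [y _ <-].
  by case: M_neq0 => y My; exists `|Phis - y|, y.
rewrite ler_pXn2r ?nnegrE//; last exact: normr_ge0.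
by apply: ge_inf => //; exists (PhiMN (fun i => X i w)).
Qed.
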